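(* Let $G$ be an untagged $\mathfrak{sl}_n$ web. Then its base stranding $S_0^G$ is a valid stranding of $G$.
   Context: Webs. Fix $n\ge2$. An untagged $\mathfrak{sl}_n$ web is a finite directed plane graph embedded in the closed half-plane below a horizontal boundary axis, considered up to planar isotopy relative to the boundary, whose edges carry weights in $\{1,\dots,n-1\}$; boundary vertices are univalent and lie on the axis; all other (interior) vertices are trivalent; directed weighted closed loops without vertices are allowed as components. For a vertex $v$ and incident edge $e$ put $\sigma_v(e)=1$ if $e$ is directed into $v$ and $-1$ if out of $v$. At each interior vertex $v$ with incident edges $e_1,e_2,e_3$ of weights $\ell_1,\ell_2,\ell_3$ one requires $\sum_i\sigma_v(e_i)\ell_i\equiv 0 \pmod n$. Strandings. A stranding $S$ of $G$ is a collection of directed paths in $G$ (simple strands), each with a color in $\{1,\dots,n-1\}$, each either closed or with both endpoints on the boundary, paths of the same color being pairwise disjoint. For an edge $e$, $S_+(e)$ (resp. $S_-(e)$) is the set of colors of strands running along $e$ with (resp. against) its direction, $S(e)=S_+(e)\sqcup S_-(e)$, and $\alpha_c^\vee(e)=1,-1,0$ according to $c\in S_+(e)$, $c\in S_-(e)$, $c\notin S(e)$. $S$ is valid if for every edge $e$ of weight $\ell$: (1) the nonzero values $\alpha_c^\vee(e)$ alternate in sign as $c$ increases; (2) with $c_{\max}$ the largest color in $S(e)$, $\sum_{c=1}^{n-1}\alpha_c^\vee(e)c$ equals $\ell$ if $c_{\max}\in S_+(e)$ and $\ell-n$ if $c_{\max}\in S_-(e)$ (in particular $S(e)\neq\emptyset$).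 Base stranding. Let $G^*$ be the planar dual: its vertices are the faces of $G$ in the half-plane, and each edge $e$ of $G$ gives an edge $e^*$ of $G^*$ with the same weight, crossing $e$ and directed from the face on the left of $e$ to the face on the right of $e$. For faces $A,B$ and a path $P$ in $G^*$ from $A$ to $B$, the signed sum modulo $n$ of the weights along $P$ (a weight is added when the edge is traversed forward and subtracted when traversed backward) depends only on $A,B$ and is denoted $dist_n(A,B)\in\{0,\dots,n-1\}$. Let $U$ be the unbounded face. The base stranding $S_0^G$ is obtained as follows: for each face $A$ with $c=dist_n(U,A)\ne0$, insert a clockwise simple strand of color $c$ around the boundary of $A$ (that is, each edge of $G$ bordering $A$ carries a strand of color $c$ directed so that $A$ is on its right), erasing any portion lying on the horizontal axis. Faces with $dist_n(U,A)=0$ contribute no strand. *)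

(* Defs.v *)
From mathcomp Require Import all_boot all_order all_algebra perm.

Set Implicit Arguments.
Unset Strict Implicit.
Unset Printing Implicit Defensive.

Import GRing.Theory.

Local Open Scope ring_scope.

(* A plane graph in the lower half-plane, up to planar isotopy relative to the
   axis, is encoded as a combinatorial map together with its faces; the
   conditions that make such data a web are in [is_web].
   - Each edge e carries two darts: (e, true) runs along the direction of e and
     (e, false) against it.
   - [rot d] is the dart following d counterclockwise around the vertex that d
     leaves; the vertices are the orbits of [rot].
   - [bnd] lists, from left to right, the darts leaving the boundary vertices.
   - [rface d] is the face on the right of d.  Distinct contours may bound the
     same face, which is how the relative position of the connected components
     is recorded.
   - [outer] is the unbounded face.
   - A closed loop without vertices is an edge e such that [rot] exchanges
     (e, true) and (e, false): a marker of degree 2 is put on the loop. *)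
Record web_data := WebData {
  edge : finType;
  weight : edge -> nat;
  rot : {perm (edge * bool)};
  bnd : seq (edge * bool);
  face : finType;
  outer : face;
  rface : edge * bool -> face
}.

Section WebData.

Variable G : web_data.

Definition dart : finType := (edge G * bool)%type.

Definition flip (d : dart) : dart := (d.1, ~~ d.2).

Definition lface (d : dart) : face G := rface (flip d).

Definition tail (d : dart) : {set dart} := porbit (rot G) d.
Definition head (d : dart) : {set dart} := tail (flip d).

(* For a dart d leaving v: the edge is directed out of v iff d is forward. *)
Definition sigma (d : dart) : int := if d.2 then -1 else 1.

(* The rotation system of the plane graph obtained by shrinking the axis, along
   with everything above it, to one point: that point has the boundary darts
   around it, in counterclockwise order from left to right. *)
Definition axis_rot (d : dart) : dart :=
  if d \in bnd G then next (bnd G) d else rot G d.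

Definition linked (d d' : dart) : bool :=
  (d' == flip d) || (d' == axis_rot d).

(* A path in the dual graph is a sequence of darts: the dart d stands for the
   traversal of the dual edge from the face on the left of d to the face on its
   right, which is forward iff d is. *)
Fixpoint dual_path (A : face G) (p : seq dart) (B : face G) : bool :=
  if p is d :: p' then (lface d == A) && dual_path (rface d) p' B else A == B.

Definition signed_weight (d : dart) : int :=
  if d.2 then (weight d.1)%:Z else - (weight d.1)%:Z.

Definition dual_length (p : seq dart) : int := \sum_(d <- p) signed_weight d.

(* [corner]: the corner between two consecutive darts leaving a vertex (or the
   axis) belongs to a single face.
   [euler]: Euler's formula V - E + F = 1 + C for the graph with the axis
   shrunk to a point (loop markers count as vertices).  When there is no
   boundary vertex this point is isolated; it is then counted neither in V nor
   in C.  Along with [corner] and [dual_connected], the formula says that every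
   component has genus 0 and that the components are glued along faces in a
   tree-like way, i.e., that the graph is drawn in the plane. *)
Record is_web (n : nat) : Prop := IsWeb {
  weight_range : forall e : edge G, (0 < weight e < n)%N;
  bnd_uniq : uniq (bnd G);
  bnd_univalent : forall d : dart, (d \in bnd G) = (rot G d == d);
  interior_degree : forall d : dart, d \notin bnd G ->
    #|tail d| = 3%N \/ tail d = [set d; flip d];
  vertex_congruence : forall d : dart, #|tail d| = 3%N ->
    (n %| \sum_(x in tail d) sigma x * (weight x.1)%:Z)%Z;
  corner : forall d : dart, lface d = rface (axis_rot d);
  outer_left : forall d : dart, ohead (bnd G) = Some d -> rface d = outer G;
  dual_connected : forall A B : face G, exists p, dual_path A p B;
  euler : (fcard axis_rot predT + #|face G|
             = #|edge G| + 1 + n_comp linked predT)%N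
}.

(* Strands are directed paths, given by their sequence of darts; a stranding
   lists coloured strands. *)
Definition consecutive (d d' : dart) : bool := head d == tail d'.

Definition closed_strand (p : seq dart) : bool :=
  [&& p != [::], cycle consecutive p, uniq [seq d.1 | d <- p]
    & uniq [seq tail d | d <- p]].

Definition open_strand (p : seq dart) : bool :=
  if p is d :: p' then
    [&& path consecutive d p', uniq [seq x.1 | x <- p],
        uniq (rcons [seq tail x | x <- p] (head (last d p'))),
        d \in bnd G & flip (last d p') \in bnd G]
  else false.

Definition strand_vertices (p : seq dart) : seq {set dart} :=
  [seq tail d | d <- p] ++ [seq head d | d <- p].

Definition same_color_disjoint (s t : nat * seq dart) : bool :=
  (s.1 == t.1) ==> ~~ has (mem (strand_vertices s.2)) (strand_vertices t.2).

Definition is_stranding (n : nat) (S : seq (nat * seq dart)) : bool :=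
  all (fun s => (0 < s.1 < n)%N && (closed_strand s.2 || open_strand s.2)) S
  && pairwise same_color_disjoint S.

Definition carries (S : seq (nat * seq dart)) (d : dart) (c : nat) : bool :=
  has (fun s => (s.1 == c) && (d \in s.2)) S.

Definition Splus S (e : edge G) (c : nat) : bool := carries S (e, true) c.
Definition Sminus S (e : edge G) (c : nat) : bool := carries S (e, false) c.
Definition Scolors S (e : edge G) (c : nat) : bool :=
  Splus S e c || Sminus S e c.

Definition alpha S (e : edge G) (c : nat) : int :=
  if Splus S e c then 1 else if Sminus S e c then -1 else 0.

Definition alternating (n : nat) S (e : edge G) : bool :=
  sorted (fun x y : int => y == - x)
    [seq a <- [seq alpha S e c | c <- iota 1 n.-1] | a != 0].

Definition weighted (n : nat) S (e : edge G) : Prop :=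
  exists cmax : nat,
    [/\ Scolors S e cmax,
        forall c, Scolors S e c -> (c <= cmax)%N
      & \sum_(1 <= c < n) alpha S e c * c%:Z
          = if Splus S e cmax then (weight e)%:Z else (weight e)%:Z - n%:Z].

Definition valid_stranding (n : nat) (S : seq (nat * seq dart)) : Prop :=
  is_stranding n S /\
  forall e : edge G, alternating n S e /\ weighted n S e.

(* The dart following d on the contour of the face on its right, the axis being
   shrunk to a point. *)
Definition contour_next (d : dart) : dart := axis_rot (flip d).

(* The piece of contour from a boundary dart d to the next point of the axis. *)
Definition boundary_arc (d : dart) : seq dart :=
  let c := orbit contour_next d in
  take (find (fun x => flip x \in bnd G) c).+1 c.

(* The clockwise contours of A, deprived of their portions on the axis: the
   contours that meet the axis are cut there into arcs, and each of the others
   is a closed strand, listed from a representative of its orbit. *)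
Definition face_strands (A : face G) : seq (seq dart) :=
  [seq boundary_arc d | d <- bnd G & rface d == A] ++
  [seq orbit contour_next d | d <- enum dart
     & [&& rface d == A, d \in froots contour_next
         & ~~ has (mem (bnd G)) (orbit contour_next d)]].

End WebData.

Record web (n : nat) := Web {
  underlying :> web_data;
  webP : is_web underlying n
}.

(* The sum is read off a chosen path from A to B; nothing in [is_web] assumes
   that it does not depend on the path. *)
Definition dist (n : nat) (G : web n) (A B : face G) : nat :=
  `|(dual_length (xchoose (dual_connected (webP G) A B)) %% n)%Z|%N.

Definition base_stranding (n : nat) (G : web n) : seq (nat * seq (dart G)) :=
  flatten [seq [seq (dist (outer G) A, p) | p <- face_strands A]
            | A <- enum (face G) & dist (outer G) A != 0%N].

(* Main.v *)
Require Import Defs.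
From mathcomp Require Import all_boot all_order all_algebra perm.
From mathcomp Require Import zify.

(* The weights form a 1-chain with values in Z/n whose boundary vanishes at
   every vertex: at interior vertices by the congruence, at the axis because the
   boundaries at all the vertices add up to 0.  Planarity makes this cycle the
   coboundary of a function on the faces.  With V vertices, E edges, F faces, C
   components and m = #|R|: every function on the vertices is a boundary modulo
   one value per component, so there are at most m ^ (E + C - V) cycles; by
   connectedness of the dual graph there are exactly m ^ (F - 1) coboundaries,
   all of them cycles, and F - 1 = E + C - V by Euler's formula.  Counting
   rather than comparing dimensions avoids any assumption on the ring.

   Hence the colours of the two faces along an edge of weight l differ by l
   modulo n, which gives both conditions of validity.  In particular they are
   distinct, so the at most three corners at a vertex have distinct colours:
   contours of one colour meet a vertex at most once, and so are simple and
   disjoint. *)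

Set Implicit Arguments.
Unset Strict Implicit.
Unset Printing Implicit Defensive.

(* [Defs] is imported again to shadow MathComp's [rot] and [head]. *)
Import GRing.Theory Num.Theory Defs.

Local Open Scope ring_scope.

Lemma pairwise_flatten (T : Type) (r : rel T) (ss : seq (seq T)) :
  pairwise r (flatten ss) = all (pairwise r) ss && pairwise (allrel r) ss.
Proof.
elim: ss => //= s ss IHss; rewrite pairwise_cat IHss.
have -> : allrel r s (flatten ss) = all (allrel r s) ss.
  by elim: ss {IHss} => [|t ss IHss] /=; rewrite ?allrel0r // allrel_catr IHss.
by rewrite [RHS]andbACA [LHS]andbA (andbC (pairwise r s)).
Qed.

(** * The rotation system with the axis shrunk to a point *)

Section Rotation.

Variables (n : nat) (G : web_data).
Hypothesis webG : is_web G n.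
Implicit Types d x y : dart G.

Lemma flipK : involutive (@flip G).
Proof. by case=> e b; rewrite /flip /= negbK. Qed.

Lemma lface_flip d : lface (flip d) = rface d.
Proof. by rewrite /lface flipK. Qed.

Lemma rot_bnd d : (rot G d \in bnd G) = (d \in bnd G).
Proof. by rewrite !(bnd_univalent webG) (inj_eq perm_inj). Qed.

Lemma axis_rot_interior d : d \notin bnd G -> axis_rot d = rot G d.
Proof. by rewrite /axis_rot => /negPf->. Qed.

Lemma axis_rot_bnd d : (axis_rot d \in bnd G) = (d \in bnd G).
Proof.
by rewrite /axis_rot; case: ifP => db; rewrite ?mem_next ?rot_bnd db.
Qed.

Lemma axis_rot_inj : injective (@axis_rot G).
Proof.
move=> x y eq_xy; have := axis_rot_bnd x; rewrite eq_xy axis_rot_bnd.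
move: eq_xy; rewrite /axis_rot; case: ifP => _; case: ifP => // _.
  move=> eq_xy _; rewrite -(prev_next (bnd_uniq webG) x) eq_xy.
  by rewrite prev_next ?(bnd_uniq webG).
by move=> /perm_inj.
Qed.

Lemma contour_next_inj : injective (@contour_next G).
Proof. by move=> x y /axis_rot_inj /(can_inj flipK). Qed.

Lemma rface_contour_next d : rface (contour_next d) = rface d.
Proof. by rewrite /contour_next -(corner webG) lface_flip. Qed.

Lemma fconnect_axis_rot_bnd d x :
  d \in bnd G -> fconnect (@axis_rot G) d x = (x \in bnd G).
Proof.
move=> db; apply: fconnect_cycle => //.
have := cycle_next (bnd_uniq webG).
apply: (sub_in_cycle (P := mem (bnd G))); last exact/allP.
by move=> y z yb _ /=; rewrite /axis_rot yb.
Qed.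

Lemma fconnect_axis_rot_interior d x :
  d \notin bnd G -> fconnect (@axis_rot G) d x = (x \in tail d).
Proof.
move=> db.
have iterE i : iter i (@axis_rot G) d \notin bnd G
    /\ iter i (@axis_rot G) d = iter i (rot G) d.
  elim: i => //= i [IHb IHi].
  by rewrite axis_rot_bnd IHb axis_rot_interior // IHi.
apply/idP/porbitP => [/iter_findex <- | [i ->]].
  by exists (findex (@axis_rot G) d x); rewrite permX (iterE _).2.
by rewrite permX -(iterE _).2 fconnect_iter.
Qed.

(** [flip] is an involution, and a step of [axis_rot] is undone by iterating it, since it is
    injective on a finite type. Symmetry is what makes [roots] pick one dart per component. *)
Lemma linked_sym : connect_sym (@linked G).
Proof.
have sub : subrel (connect (@linked G)) (connect [rel x y | linked y x]).
  apply: connect_sub => x y /orP[] /eqP->.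
    by rewrite connect1 //= /linked flipK eqxx.
  rewrite connect_rev /=.
  have /(connect_sub _) -> // : fconnect (@axis_rot G) (axis_rot x) x.
    by rewrite (fconnect_sym axis_rot_inj) fconnect1.
  by move=> a b /eqP <-; rewrite connect1 //= /linked eqxx orbT.
move=> x y; apply/idP/idP => /sub; by rewrite connect_rev.
Qed.

End Rotation.

(** * Cycles and coboundaries over a finite abelian group, by counting *)

Section Potential.

Variables (n : nat) (G : web_data) (R : finZmodType).
Hypothesis webG : is_web G n.

Definition edge_chain := {ffun edge G -> R}.

Definition signed (w : edge_chain) (d : dart G) : R :=
  if d.2 then w d.1 else - w d.1.

(** Orbits are represented by their roots, so that the cardinal is the [fcard] of Euler's formula.
    The boundary darts, if any, make up a single vertex. *)
Definition vertex : finType := {d : dart G | froots (@axis_rot G) d}.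

Definition vertex_of (d : dart G) : vertex :=
  exist _ (froot (@axis_rot G) d)
    (roots_root (fconnect_sym (axis_rot_inj webG)) d).

Lemma vertex_ofP d d' :
  (vertex_of d == vertex_of d') = fconnect (@axis_rot G) d d'.
Proof. by rewrite -val_eqE /= (root_connect (fconnect_sym (axis_rot_inj webG))). Qed.

Lemma vertex_of_axis_rot d : vertex_of (axis_rot d) = vertex_of d.
Proof. by apply/esym/eqP; rewrite vertex_ofP fconnect1. Qed.

Lemma vertex_of_val (v : vertex) : vertex_of (val v) = v.
Proof. by apply: val_inj; apply/eqP; exact: (valP v). Qed.

Definition boundary (w : edge_chain) : {ffun vertex -> R} :=
  [ffun v => \sum_(d : dart G | vertex_of d == v) signed w d].

Definition coboundary (phi : {ffun face G -> R}) : edge_chain :=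
  [ffun e => phi (rface (e, true)) - phi (lface ((e, true) : dart G))].

Lemma signedB w w' d : signed (w - w') d = signed w d - signed w' d.
Proof. by rewrite /signed !ffunE; case: d.2; rewrite ?opprD. Qed.

Lemma boundaryB w w' : boundary (w - w') = boundary w - boundary w'.
Proof.
apply/ffunP=> v; rewrite !ffunE -sumrB; apply: eq_bigr => d _; exact: signedB.
Qed.

Lemma signed_coboundary phi d :
  signed (coboundary phi) d = phi (rface d) - phi (lface d).
Proof.
by case: d => e [] /=; rewrite /signed /= ffunE //= opprB.
Qed.

(** By [corner], the face on the left of a dart is the face on the right of the next one, so the sum
    around a vertex telescopes. *)
Lemma boundary_coboundary phi : boundary (coboundary phi) = 0.
Proof.
apply/ffunP=> v; rewrite !ffunE.
under eq_bigr do rewrite signed_coboundary (corner webG).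
rewrite sumrB; apply/eqP; rewrite subr_eq0; apply/eqP.
rewrite (reindex_inj (axis_rot_inj webG)).
by apply: eq_bigl => d; rewrite vertex_of_axis_rot.
Qed.

Definition component : finType := {d : dart G | roots (@linked G) d}.

(** Boundaries sum to 0 on each component; this adds the missing degree of freedom, as an arbitrary
    value at the vertex of the root of each component. *)
Definition sources (z : {ffun component -> R}) : {ffun vertex -> R} :=
  [ffun v => \sum_(c : component | vertex_of (val c) == v) z c].

Lemma sourcesB z z' : sources (z - z') = sources z - sources z'.
Proof.
apply/ffunP=> v; rewrite !ffunE -sumrB; apply: eq_bigr => d _.
by rewrite !ffunE.
Qed.

Definition point (r : R) (d : dart G) : {ffun vertex -> R} :=
  [ffun v => if vertex_of d == v then r else 0].

Lemma signed_sum_edges (P : pred (dart G)) w :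
  \sum_(d | P d) signed w d =
    \sum_e ((if P (e, true) then w e else 0) - (if P (e, false) then w e else 0)).
Proof.
rewrite big_mkcond /=.
rewrite (eq_bigr (fun d : dart G => if P (d.1, d.2) then signed w (d.1, d.2) else 0));
  last by case.
rewrite -(pair_bigA _ (fun e b => if P (e, b) then signed w (e, b) else 0)) /=.
apply: eq_bigr => e _; rewrite big_bool /signed /=.
by case: (P (e, false)); rewrite ?oppr0.
Qed.

Lemma boundary_edge r d : exists w, boundary w = point r d - point r (flip d).
Proof.
case: d => e b.
(* The sign compensates for a dart that runs against its edge. *)
exists [ffun e' => if e' == e then (if b then r else - r) else 0].
apply/ffunP=> v; rewrite !ffunE signed_sum_edges (bigD1 e) //= big1 => [|e' e'e].
  rewrite !ffunE eqxx addr0; case: b => //=.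
  by do 2!case: ifP => _; rewrite ?oppr0 ?opprK ?addr0 ?add0r // addrC.
by rewrite !ffunE (negPf e'e) !if_same subr0.
Qed.

(** The values reached form a subgroup. It contains the point masses at roots of components;
    [boundary_edge] moves a point mass across an edge, hence along any [linked] path to the root;
    and point masses generate everything. *)
Lemma boundary_sources_surj y : exists w z, y = boundary w + sources z.
Proof.
pose P y := exists w z, y = boundary w + sources z.
have PB a b : P a -> P b -> P (a - b).
  move=> [w [z ->]] [w' [z' ->]]; exists (w - w'), (z - z').
  by rewrite boundaryB sourcesB opprD addrACA.
have P0 : P 0.
  exists 0, 0; apply/ffunP=> v; rewrite !ffunE !big1 ?addr0 // => [c|d] _.
    by rewrite ffunE.
  by rewrite /signed ffunE oppr0 if_same.
have PD a b : P a -> P b -> P (a + b).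
  by move=> Pa Pb; rewrite -[b]opprK -[- b]add0r; do 2!apply: (PB) => //.
have Pedge r d : P (point r d - point r (flip d)).
  have [w w_d] := boundary_edge r d; exists w, 0; rewrite w_d.
  apply/ffunP=> v; rewrite !ffunE [X in _ = _ + X]big1 ?addr0 // => c _.
  by rewrite ffunE.
have Proot r d : roots (@linked G) d -> P (point r d).
  move=> rd; pose c : component := exist _ d rd.
  exists 0, [ffun c' => if c' == c then r else 0].
  apply/ffunP=> v; rewrite !ffunE big1 ?add0r => [|d' _]; last first.
    by rewrite /signed ffunE oppr0 if_same.
  under eq_bigr do rewrite ffunE.
  rewrite -big_mkcondr /=; case: ifP => dv.
    rewrite (big_pred1 c) // => c' /=.
    by case: (c' =P c) => [->|]; rewrite ?andbF //= dv.
  by rewrite big1 // => c' /andP[/[swap] /eqP-> /=]; rewrite dv.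
have Ppoint r d : P (point r d).
  have /connectP[p dp def_r] := connect_root (@linked G) d.
  have: roots (@linked G) (last d p).
    by rewrite -def_r; exact/roots_root/linked_sym/webG.
  elim: p d dp {def_r} => [|x p IHp] d /= => [_ | /andP[dx xp] /(IHp x xp) Px].
    exact: Proot.
  case/orP: dx Px => /eqP-> Px.
    by rewrite -[point r d](subrK (point r (flip d))); apply: PD.
  suff -> : point r d = point r (axis_rot d) by [].
  by apply/ffunP=> v; rewrite !ffunE vertex_of_axis_rot.
suff -> : y = \sum_v point (y v) (val v).
  by apply: (big_ind P) => // v _; apply: Ppoint.
apply/ffunP=> v; rewrite sum_ffunE (bigD1 v) //= big1 => [|v' v'v].
  by rewrite ffunE vertex_of_val eqxx addr0.
by rewrite ffunE vertex_of_val (negPf v'v).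
Qed.

Definition cycles : {set edge_chain} := [set w | boundary w == 0].

(** A section [s] of the surjection above, translated by cycles, embeds pairs (vertex function,
    cycle) into pairs (chain, sources): adding a cycle does not change the boundary, so the vertex
    function can be recovered, and then the cycle. *)
Lemma card_cycles : (#|R| ^ #|vertex| * #|cycles| <= #|R| ^ (#|edge G| + #|component|))%N.
Proof.
have /all_sig[s sP] : forall y,
      {wz : edge_chain * {ffun component -> R} | y == boundary wz.1 + sources wz.2}.
  by move=> y; apply: sigW; have [w [z ->]] := boundary_sources_surj y; exists (w, z).
pose f (yk : {ffun vertex -> R} * edge_chain) := ((s yk.1).1 + yk.2, (s yk.1).2).
have inj_f : {in setX setT cycles &, injective f}.
  move=> [y k] [y' k'] /setXP[_ /=]; rewrite inE => /eqP bk.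
  move=> /setXP[_ /=]; rewrite inE => /eqP bk' [eq1 eq2].
  have bD w w' : boundary w' = 0 -> boundary (w + w') = boundary w.
    by move=> bw'; rewrite -[w in RHS](addrK w') boundaryB bw' subr0.
  have eq_y : y = y'.
    by rewrite (eqP (sP y)) (eqP (sP y')) eq2 -(bD (s y).1 k) // eq1 bD.
  by move: eq1; rewrite -eq_y => /addrI ->.
rewrite expnD -!card_ffun -[X in (_ <= X)%N]card_prod.
rewrite -cardsT -cardsX -(card_in_imset inj_f).
exact: max_card.
Qed.

(** Recording [phi (outer G)] beside the coboundary makes the map injective, by dual connectedness.
    Its image lies in the product of the cycles with [R] and is at least as large, so [(w, 0)] is
    attained. *)
Lemma cycle_coboundary w : w \in cycles ->
  exists phi, w = coboundary phi /\ phi (outer G) = 0.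
Proof.
pose f phi := (coboundary phi, phi (outer G)).
have inj_f : injective f.
  move=> phi psi [eqd eqo]; apply/ffunP=> A.
  have [p] := dual_connected webG (outer G) A.
  elim: p (outer G) eqo => [|d p IHp] B eqB /= => [/eqP <- //|].
  move=> /andP[/eqP dB]; apply: IHp; apply: (addIr (- phi (lface d))).
  by rewrite -signed_coboundary eqd signed_coboundary dB eqB.
have sub_f : [set f phi | phi : {ffun face G -> R}] \subset setX cycles setT.
  by apply/subsetP=> _ /imsetP[phi _ ->]; rewrite !inE boundary_coboundary eqxx.
have R0 : (0 < #|R|)%N by apply/card_gt0P; exists 0.
have eq_f : [set f phi | phi : {ffun face G -> R}] = setX cycles setT.
  apply/eqP; rewrite eqEcard sub_f card_imset // cardsX cardsT card_ffun.
  rewrite -(@leq_pmul2l (#|R| ^ #|vertex|)) ?expn_gt0 ?R0 // mulnA.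
  apply: leq_trans (leq_mul card_cycles (leqnn _)) _.
  rewrite -expnD -expnSr leq_eqVlt; apply/orP; left; apply/eqP.
  (* The exponents agree by Euler's formula: E + C + 1 = V + F. *)
  congr (_ ^ _)%N; rewrite /vertex /component !card_sig.
  move: (euler webG); rewrite /n_comp_mem /=.
  have -> : #|predI (froots (@axis_rot G)) predT| = #|[pred x | froots (@axis_rot G) x]|.
    by apply: eq_card => x; rewrite !inE andbT.
  have -> : #|predI (roots (@linked G)) predT| = #|[pred x | roots (@linked G) x]|.
    by apply: eq_card => x; rewrite !inE andbT.
  by move=> ->; rewrite addnAC addn1.
move=> wc; have : (w, 0 : R) \in setX cycles setT by rewrite inE wc inE.
by rewrite -eq_f => /imsetP[phi _ [-> eq0]]; exists phi.
Qed.

End Potential.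

(** * The distance modulo [n] as a potential of the weights *)

Section Distance.

Variables (n : nat) (G : web n).
Hypothesis n_gt1 : (1 < n)%N.

Lemma intr_Zp_dvd (m : int) : (n %| m)%Z -> m%:~R = 0 :> 'Z_n.
Proof.
by case/dvdzP=> k ->; rewrite intrM -[n%:Z%:~R]/(n%:R) pchar_Zp ?mulr0.
Qed.

Definition weight_chain : edge_chain G 'Z_n := [ffun e => (weight e)%:R].

Lemma signed_weight_chain d : signed weight_chain d = (signed_weight d)%:~R.
Proof.
by rewrite /signed /signed_weight ffunE; case: d.2; rewrite ?rmorphN.
Qed.

Lemma boundary_weight_interior (d : dart G) : d \notin bnd G ->
  boundary (webP G) weight_chain (vertex_of (webP G) d) = 0.
Proof.
move=> db; rewrite ffunE.
rewrite (eq_bigl (fun x : dart G => x \in tail d)); last first.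
  by move=> x; rewrite eq_sym vertex_ofP (fconnect_axis_rot_interior (webP G)).
case: (interior_degree (webP G) db) => [deg3 | ->].
  have /intr_Zp_dvd := vertex_congruence (webP G) deg3.
  (* [sigma] counts incoming edges positively and [signed] outgoing ones, so the flux is the
     opposite of the sum in the congruence. *)
  rewrite rmorph_sum /= => sum0; rewrite -[RHS]oppr0 -[in RHS]sum0 -sumrN.
  apply: eq_bigr => x _; rewrite signed_weight_chain /signed_weight /sigma.
  by case: x.2; rewrite ?mulN1r ?mul1r ?rmorphN ?opprK.
rewrite big_setU1 ?big_set1 /= ?inE.
  by case: d {db} => e []; rewrite /signed /= ?subrr // addNr.
by case: d {db} => e []; rewrite /flip xpair_eqE eqxx.
Qed.

(* Every edge leaves one vertex and enters another, so the fluxes through all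
   vertices add up to 0; this gives the condition at the axis. *)
Lemma weight_cycle : weight_chain \in cycles 'Z_n (webP G).
Proof.
rewrite inE; apply/eqP/ffunP=> v; rewrite [RHS]ffunE -[v](vertex_of_val (webP G)).
have [vb|] := boolP (val v \in bnd G); last exact: boundary_weight_interior.
have : \sum_v boundary (webP G) weight_chain v = 0.
  transitivity (\sum_d signed weight_chain d).
    rewrite (partition_big (vertex_of (webP G)) xpredT) //=.
    by apply: eq_bigr => v' _; rewrite ffunE.
  by rewrite signed_sum_edges big1 // => e _; rewrite subrr.
rewrite vertex_of_val (bigD1 v) //= big1 ?addr0 // => v' v'v.
rewrite -[v'](vertex_of_val (webP G)) boundary_weight_interior //.
apply: contra v'v => v'b.
rewrite -(vertex_of_val (webP G) v) -(vertex_of_val (webP G) v').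
by rewrite vertex_ofP (fconnect_axis_rot_bnd (webP G)).
Qed.

Lemma dist_lt (A B : face G) : (dist A B < n)%N.
Proof.
have n_gt0 := ltnW n_gt1.
by rewrite /dist -ltz_nat gez0_abs ?ltz_pmod ?modz_ge0 // eqz_nat -lt0n.
Qed.

(** A potential of the weights vanishing at [outer G] changes along a dual path by the length of
    that path modulo [n]. So [dist] reduces to this potential whichever path was chosen, and
    crossing an edge adds its weight. *)
Lemma dist_rface e : dist (outer G) (rface ((e, true) : dart G)) =
  ((dist (outer G) (lface ((e, true) : dart G)) + weight e) %% n)%N.
Proof.
have [phi [w_phi phi0]] := cycle_coboundary weight_cycle.
have step d : phi (rface d) = phi (lface d) + (signed_weight d)%:~R.
  by rewrite -signed_weight_chain w_phi signed_coboundary addrCA subrr addr0.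
have phi_path A p B : dual_path A p B -> phi B = phi A + (dual_length p)%:~R.
  rewrite /dual_length; elim: p A => [|d p IHp] A /=.
    by move=> /eqP->; rewrite big_nil addr0.
  by move=> /andP[/eqP<- /IHp->]; rewrite step big_cons intrD addrA.
have distE A : (dist (outer G) A)%:R = phi A.
  rewrite /dist; set p := xchoose _.
  have /phi_path := xchooseP (dual_connected (webP G) (outer G) A).
  rewrite -/p phi0 add0r => ->.
  rewrite [X in _ = X%:~R](divz_eq _ n%:Z) intrD intr_Zp_dvd ?dvdz_mull // add0r.
  by rewrite -[X in _ = X%:~R]gez0_abs // modz_ge0 // eqz_nat -lt0n ltnW.
(* Both sides are residues below [n], so they may be compared in ['Z_n]. *)
rewrite -[LHS](modn_small (dist_lt _ _)) -!(val_Zp_nat n_gt1); congr val.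
by rewrite natrD !distE step.
Qed.

End Distance.

(** * Colours of darts at an edge and at a vertex *)

Section Strands.

Variables (n : nat) (G : web n).
Hypothesis n_gt1 : (1 < n)%N.
Implicit Types (d x y : dart G) (p q : seq (dart G)).

Local Notation cnext := (@contour_next G).
Let webG : is_web G n := webP G.

Definition color d : nat := dist (outer G) (rface d).

(** The colour on the left and the weight are below [n], so their sum wraps around at most once. The
    two cases become the values [weight e] and [weight e - n] of the second validity condition. *)
Lemma color_edge e : (color (e, true) = color (e, false) + weight e)%N \/
  (color (e, true) + n = color (e, false) + weight e)%N.
Proof.
have := dist_rface n_gt1 e; have := weight_range webG e.
have := dist_lt n_gt1 (outer G) (lface ((e, true) : dart G)).
rewrite -/(color (e, true)) /lface -/(color (e, false)).
set a := color _; set b := color _ => a_lt /andP[_ w_lt] ->.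
have [lt_n|le_n] := ltnP (a + weight e) n; first by left; rewrite modn_small.
right; rewrite -[in LHS](subnK le_n) modnDr modn_small ?subnK //; lia.
Qed.

Lemma color_flip d : color (flip d) != color d.
Proof.
suff neq e : color (e, true) != color (e, false).
  by case: d => e []; [rewrite eq_sym|]; exact: neq.
have := weight_range webG e; have := color_edge e; lia.
Qed.

Lemma color_contour_next d : color (cnext d) = color d.
Proof. by rewrite /color (rface_contour_next webG). Qed.

Lemma color_rot d : d \notin bnd G -> color (rot G d) = color (flip d).
Proof. by move=> /(axis_rot_interior) <-; rewrite /color -(corner webG). Qed.

Lemma tail_bnd d : d \in bnd G -> tail d = [set d].
Proof.
rewrite (bnd_univalent webG) => /eqP fix_d; apply/setP=> x; rewrite inE.
apply/porbitP/eqP => [[i ->]|->]; last by exists 0%N; rewrite perm1.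
by rewrite permX; elim: i => //= i ->.
Qed.

Lemma tail_rot d : tail (rot G d) = tail d.
Proof.
by apply/eqP; rewrite eq_porbit_mem -[in X in X \in _](expg1 (rot G)) mem_porbit.
Qed.

Lemma head_contour_next d : flip d \notin bnd G -> tail (cnext d) = head d.
Proof. by move=> db; rewrite /contour_next axis_rot_interior // tail_rot. Qed.

Lemma contour_next_bnd d : (cnext d \in bnd G) = (flip d \in bnd G).
Proof. exact: axis_rot_bnd webG _. Qed.

Lemma edge_inj x y : color x = color y -> x.1 = y.1 -> x = y.
Proof.
case: x y => e b [e' b'] + /= eq_e; rewrite -eq_e => eq_c.
have := color_flip (e, b); rewrite eq_c /flip /=.
by case: b b' {eq_c} => -[]; rewrite ?eqxx.
Qed.

(* Consecutive faces around a vertex have different colours, and a vertex has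
   at most three corners. *)
Lemma tail_inj x y : color x = color y -> tail x = tail y -> x = y.
Proof.
move=> eq_c /eqP; rewrite eq_sym eq_porbit_mem => xy.
have [xb|xi] := boolP (x \in bnd G).
  by move: xy; rewrite -/(tail x) tail_bnd // inE => /eqP.
have := interior_degree webG xi; case=> [deg3|deg2]; last first.
  move: xy; rewrite -/(tail x) deg2 !inE => /pred2P[-> // | y_flip].
  by have := color_flip x; rewrite -y_flip eq_c eqxx.
have rot3 : rot G (rot G (rot G x)) = x.
  by have := iter_porbit (rot G) x; rewrite -/(tail x) deg3.
have neq d : d \notin bnd G -> color (rot G d) != color d.
  by move=> di; rewrite color_rot ?color_flip.
move: xy; rewrite porbit_traject -/(tail x) deg3 /= !inE => /or3P[] /eqP // y_rot.
  by have := neq x xi; rewrite -y_rot eq_c eqxx.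
have := neq y; rewrite {1 2}y_rot !(rot_bnd webG) rot3 eq_c eqxx.
by move=> /(_ xi).
Qed.

(** At an interior vertex, [tail_inj] leaves only one outgoing dart of the given colour, and the
    contour of [x] supplies it. At a boundary vertex the only outgoing dart is [flip x], whose
    colour is different. *)
Lemma contour_succ x y : color x = color y -> head x = tail y ->
  y = cnext x /\ y \notin bnd G.
Proof.
move=> eq_c eq_v; have [xb|xi] := boolP (flip x \in bnd G).
  have : y \in tail y by exact: porbit_id.
  rewrite -eq_v /head tail_bnd // inE => /eqP y_flip.
  by have := color_flip x; rewrite -y_flip eq_c eqxx.
have -> : y = cnext x.
  by apply: tail_inj; rewrite ?color_contour_next ?head_contour_next.
by rewrite contour_next_bnd.
Qed.

(** Away from the axis, both contours continue along the same dart by [contour_succ], and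
    [contour_next] is injective. *)
Lemma head_inj x y : color x = color y -> head x = head y -> x = y.
Proof.
move=> eq_c eq_v; have [xb|xi] := boolP (flip x \in bnd G).
  have : flip y \in tail (flip y) by exact: porbit_id.
  rewrite -[tail _]eq_v /head tail_bnd // inE => /eqP /(can_inj (@flipK G)) //.
have yi : flip y \notin bnd G.
  apply: contra xi => yb; have : flip x \in tail (flip x) by exact: porbit_id.
  by rewrite -/(head x) eq_v /head tail_bnd // inE => /eqP->.
have [] := @contour_succ x (cnext y).
- by rewrite color_contour_next.
- by rewrite head_contour_next.
by move=> /(contour_next_inj webG).
Qed.

(** * Contours, cut into arcs at the axis *)

Lemma rface_iter i d : rface (iter i cnext d) = rface d.
Proof. by elim: i => //= i <-; rewrite (rface_contour_next webG). Qed.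

Lemma rface_fconnect d x : fconnect cnext d x -> rface x = rface d.
Proof. by move=> /iter_findex <-; rewrite rface_iter. Qed.

Lemma boundary_arcP d : d \in bnd G -> exists i,
  [/\ boundary_arc d = traject cnext d i.+1, uniq (boundary_arc d),
      forall j, (j < i)%N -> iter j.+1 cnext d \notin bnd G
    & iter i.+1 cnext d \in bnd G].
Proof.
move=> db; set a := fun x => flip x \in bnd G.
have size_c := size_orbit cnext d.
have has_a : has a (orbit cnext d).
  (* The contour predecessor of [d] ends on the axis because [d] starts there, so the search for the
     end of the arc succeeds. *)
  apply/hasP; exists (finv cnext d).
    by rewrite -fconnect_orbit fconnect_finv.
  by rewrite /a -contour_next_bnd (f_finv (contour_next_inj webG)).
exists (find a (orbit cnext d)); have lt_i := has_a; rewrite has_find size_c in lt_i.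
rewrite /boundary_arc -/a take_uniq ?orbit_uniq // {1}/orbit take_traject //.
have nthE j : (j < order cnext d)%N ->
    iter j.+1 cnext d \in bnd G = a (nth d (orbit cnext d) j).
  by move=> lt_j; rewrite iterS contour_next_bnd nth_traject.
split=> // [j lt_j|]; last by rewrite nthE ?nth_find.
by rewrite nthE ?(before_find d lt_j) ?(ltn_trans lt_j).
Qed.

Lemma uniq_edges_tails p : uniq p -> {in p &, forall x y, color x = color y} ->
  uniq [seq x.1 | x <- p] && uniq [seq tail x | x <- p].
Proof.
move=> p_uniq eq_c; rewrite !map_inj_in_uniq ?p_uniq // => x y xp yp.
  by apply: tail_inj; exact: eq_c.
by apply: edge_inj; exact: eq_c.
Qed.

Lemma boundary_arc_color d x : d \in bnd G -> x \in boundary_arc d -> rface x = rface d.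
Proof.
by case/boundary_arcP=> i [-> _ _ _] /trajectP[j _ ->]; rewrite rface_iter.
Qed.

Lemma boundary_arc_open d : d \in bnd G -> open_strand (boundary_arc d).
Proof.
move=> db; have arc_color := boundary_arc_color db.
have eq_c : {in boundary_arc d &, forall x y, color x = color y}.
  by move=> x y /arc_color eqx /arc_color eqy; rewrite /color eqx eqy.
have [i [def_p p_uniq interior last_bnd]] := boundary_arcP db.
have /andP[uniq_e uniq_t] := uniq_edges_tails p_uniq eq_c.
have def_q : boundary_arc d = d :: traject cnext (cnext d) i by [].
rewrite def_q /open_strand -def_q uniq_e db last_traject.
rewrite -contour_next_bnd [_ \in bnd G]last_bnd rcons_uniq uniq_t !andbT.
apply/andP; split.
  apply/(pathP d) => j; rewrite size_traject => lt_j.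
  rewrite -def_q def_p.
  rewrite -[nth d (traject _ (cnext d) _) j]/(nth d (traject cnext d i.+1) j.+1).
  rewrite !nth_traject ?ltnS ?(ltnW lt_j) //= /consecutive head_contour_next //.
  by rewrite -contour_next_bnd; exact: interior.
(* The endpoint is not visited earlier: a dart of the arc leaving it would be the successor of the
   last dart and not a boundary dart, but that successor is one. *)
apply/negP=> /mapP[y yp eq_v].
have lp : iter i cnext d \in boundary_arc d by rewrite def_p; apply/trajectP; exists i.
have [def_y] := contour_succ (eq_c _ _ lp yp) eq_v.
by rewrite def_y [_ \in bnd G]last_bnd.
Qed.

Lemma orbit_closed d : ~~ has (mem (bnd G)) (orbit cnext d) ->
  closed_strand (orbit cnext d).
Proof.
move=> /hasPn no_bnd; rewrite /closed_strand.
have eq_c : {in orbit cnext d &, forall x y, color x = color y}.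
  by move=> x y; rewrite -!fconnect_orbit /color => /rface_fconnect-> /rface_fconnect->.
rewrite uniq_edges_tails ?orbit_uniq // andbT; apply/andP; split.
  by rewrite -size_eq0 size_orbit -orderSpred.
have := cycle_orbit (contour_next_inj webG) d.
apply: (sub_in_cycle (P := mem (orbit cnext d))); last exact/allP.
move=> x y _ yd /eqP def_y; rewrite /consecutive -def_y head_contour_next //.
by rewrite -contour_next_bnd [cnext x]def_y; exact: no_bnd.
Qed.

Lemma face_strands_open_closed A p : p \in face_strands A ->
  closed_strand p || open_strand p.
Proof.
rewrite mem_cat => /orP[] /mapP[d]; rewrite mem_filter.
  by move=> /andP[_ /boundary_arc_open ?] ->; apply/orP; right.
by move=> /andP[/and3P[_ _ /orbit_closed ?] _] ->; apply/orP; left.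
Qed.

Lemma rface_strand A p x : p \in face_strands A -> x \in p -> rface x = A.
Proof.
rewrite mem_cat => /orP[] /mapP[d]; rewrite mem_filter.
  by move=> /andP[/eqP <- db] -> /(boundary_arc_color db).
by move=> /andP[/and3P[/eqP <- _ _] _] ->; rewrite -fconnect_orbit => /rface_fconnect.
Qed.

Lemma strand_contour_next A p x : p \in face_strands A -> x \in p ->
  cnext x \notin bnd G -> cnext x \in p.
Proof.
rewrite mem_cat => /orP[] /mapP[d]; rewrite mem_filter; last first.
  by move=> _ -> xp _; exact: mem_orbit.
move=> /andP[_ /boundary_arcP[i [def_p _ _ last_bnd]]] ->; rewrite def_p.
case/trajectP=> j; rewrite ltnS leq_eqVlt => /predU1P[-> ->|lt_j -> _].
  by rewrite -iterS last_bnd.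
by apply/trajectP; exists j.+1.
Qed.

(** Going back from a common dart, the contour is determined. If one starting dart is met before the
    other, it is a boundary dart in the interior of the other arc, which is excluded. *)
Lemma boundary_arc_disjoint d d' x : d \in bnd G -> d' \in bnd G ->
  x \in boundary_arc d -> x \in boundary_arc d' -> d = d'.
Proof.
move=> db d'b.
have [i [-> _ int last_b]] := boundary_arcP db.
have [i' [-> _ int' last_b']] := boundary_arcP d'b.
case/trajectP=> j lt_j -> /trajectP[j' lt_j'].
wlog le_j : d d' db d'b i i' j j' int last_b int' last_b' lt_j lt_j' / (j <= j')%N.
  move=> wlg; case/orP: (leq_total j j') => le_j.
    exact: (wlg d d' db d'b i i' j j').
  by move=> /esym eq_x; apply/esym; exact: (wlg d' d d'b db i' i j' j).
rewrite -(subnKC le_j) iterD; have iter_inj : injective (iter j cnext).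
  by elim: (j) => [|k IHk] y z //= /(contour_next_inj webG) /IHk.
move=> /iter_inj; case def_k: (j' - j)%N => [|k] // def_d.
by have := int' k; rewrite -def_d db => /(_ ltac:(lia)).
Qed.

(** Contours sharing a dart are the same orbit. Hence a closed contour, free of boundary darts,
    misses every arc, and two closed contours are separated by their roots. *)
Lemma face_strands_disjoint A :
  pairwise (fun p q => ~~ has (mem p) q) (face_strands A).
Proof.
have sym := fconnect_sym (contour_next_inj webG).
have orbitC d x : x \in orbit cnext d -> d \in orbit cnext x.
  by rewrite -!fconnect_orbit sym.
rewrite pairwise_cat !pairwise_map; apply/and3P; split.
- apply/allrelP=> p q /mapP[d]; rewrite mem_filter => /andP[_ db] ->.
  case/mapP=> d'; rewrite mem_filter => /andP[/and3P[_ _ d'_nb] _] ->.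
  apply: contra d'_nb => /hasP[x xd' xd]; apply/hasP; exists d => //.
  rewrite -fconnect_orbit; apply: connect_trans (_ : fconnect cnext x d).
    by rewrite fconnect_orbit.
  by rewrite fconnect_orbit orbitC //; exact: mem_take xd.
- have : uniq [seq d <- bnd G | rface d == A] by rewrite filter_uniq ?(bnd_uniq webG).
  rewrite uniq_pairwise; apply: (sub_in_pairwise (P := mem (bnd G))) => [d d' db d'b|].
    apply: contra => /hasP[x xd' xd]; exact/eqP/(boundary_arc_disjoint db d'b xd xd').
  by apply/allP=> d; rewrite mem_filter => /andP[].
set s := filter _ _; have : uniq s by rewrite filter_uniq ?enum_uniq.
rewrite uniq_pairwise; apply: (sub_in_pairwise (P := froots cnext)) => [d d'|].
  move=> rd rd'; apply: contra => /hasP[x xd' xd].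
  have rootE y : y \in froots cnext -> froot cnext y = y by move/eqP.
  have /(fingraph.rootP sym) : fconnect cnext d d'.
    apply: connect_trans (_ : fconnect cnext x d'); rewrite fconnect_orbit //.
    exact: orbitC.
  by rewrite !rootE // => ->.
by apply/allP=> d; rewrite mem_filter => /andP[/and3P[]].
Qed.

Lemma face_strands_cover d : exists2 p, p \in face_strands (rface d) & d \in p.
Proof.
have sym := fconnect_sym (contour_next_inj webG).
pose P j := [exists b : dart G, (b \in bnd G) && (iter j cnext b == d)].
have [/existsP[b /andP[bb bd]]|no_bnd] :=
    boolP [exists b : dart G, (b \in bnd G) && fconnect cnext b d]; last first.
  exists (orbit cnext (froot cnext d)).
    rewrite mem_cat; apply/orP; right; apply/map_f; rewrite mem_filter mem_enum andbT.
    rewrite (rface_fconnect (connect_root _ d)) eqxx.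
    have -> /= : froot cnext d \in froots cnext by exact: (roots_root sym).
    apply: contra no_bnd => /hasP[b br bb]; apply/existsP; exists b.
    rewrite [_ \in _]bb sym; apply: connect_trans (connect_root _ d) _.
    by rewrite fconnect_orbit.
  by rewrite -fconnect_orbit sym connect_root.
have exP : exists j, P j.
  by exists (findex cnext b d); apply/existsP; exists b; rewrite bb iter_findex ?eqxx.
(* Among the boundary darts preceding [d] on its contour, the nearest one starts the right arc: if
   that arc ended before [d], the boundary dart following it would be nearer. *)
case: (ex_minnP exP) => j /existsP[b' /andP[b'b /eqP def_d]] min_j {b bb bd exP}.
exists (boundary_arc b').
  by rewrite mem_cat map_f // mem_filter b'b -def_d rface_iter eqxx.
have [i [-> _ _ last_b]] := boundary_arcP b'b.
apply/trajectP; exists j => //; rewrite ltnNge; apply/negP=> lt_i.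
have /min_j : P (j - i.+1)%N.
  by apply/existsP; exists (iter i.+1 cnext b'); rewrite last_b -iterD subnK ?def_d ?eqxx.
lia.
Qed.

(** * Simplicity and disjointness of the strands of one colour *)

Local Notation S := (base_stranding G).

Lemma mem_base_stranding s : s \in S ->
  exists A, [/\ s.1 = dist (outer G) A, s.1 != 0%N & s.2 \in face_strands A].
Proof.
by case/flatten_mapP=> A; rewrite mem_filter => /andP[A0 _] /mapP[p pA ->]; exists A.
Qed.

Lemma carries_base_stranding d c : carries S d c = (c == color d) && (c != 0%N).
Proof.
apply/hasP/andP => [[s /mem_base_stranding[A [s1 s0 s2]] /andP[/eqP <- ds]]|].
  by rewrite s0 s1 /color (rface_strand s2 ds) eqxx.
case=> /eqP-> c0; have [p pd dp] := face_strands_cover d.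
exists (color d, p); last by rewrite /= eqxx.
apply/flatten_mapP; exists (rface d); first by rewrite mem_filter c0 mem_enum.
exact: map_f.
Qed.

(** At the common vertex, two outgoing or two incoming darts of one colour coincide. If one enters
    and the other leaves, the latter is the contour successor of the former and is not a boundary
    dart, so it lies on both strands. *)
Lemma shared_vertex A B p q : p \in face_strands A -> q \in face_strands B ->
  dist (outer G) A = dist (outer G) B ->
  has (mem (strand_vertices p)) (strand_vertices q) -> has (mem p) q.
Proof.
move=> pA qB eqAB /hasP[v vq vp].
have eq_c x y : x \in p -> y \in q -> color x = color y.
  by move=> /(rface_strand pA) eqx /(rface_strand qB) eqy; rewrite /color eqx eqy.
move: vq vp; rewrite /= /strand_vertices !mem_cat.
move=> /orP[] /mapP[y yq ->] /orP[] /mapP[x xp eq_v]; apply/hasP.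
- by exists y => //=; rewrite (tail_inj _ eq_v) // (eq_c x y).
- have [def_y yb] := contour_succ (eq_c x y xp yq) (esym eq_v).
  by exists y => //=; rewrite def_y (strand_contour_next pA) // -def_y.
- have [def_x xb] := contour_succ (esym (eq_c x y xp yq)) eq_v.
  by exists x => //; rewrite def_x (strand_contour_next qB) // -def_x.
- by exists y => //=; rewrite (head_inj _ eq_v) // (eq_c x y).
Qed.

Lemma base_strandingP : is_stranding n S.
Proof.
apply/andP; split.
  apply/allP=> s /mem_base_stranding[A [s1 s0 /face_strands_open_closed ->]].
  by rewrite andbT lt0n s0 s1 dist_lt.
rewrite pairwise_flatten pairwise_map; apply/andP; split.
  apply/allP=> _ /mapP[A _ ->]; rewrite pairwise_map.
  have := face_strands_disjoint A.
  apply: (sub_in_pairwise (P := mem (face_strands A))) => [p q pA qA|]; last exact/allP.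
  rewrite /relpre /same_color_disjoint /= eqxx /=; apply: contra.
  exact: (shared_vertex pA qA erefl).
set s := filter _ _; have : uniq s by rewrite filter_uniq ?enum_uniq.
rewrite uniq_pairwise; apply: sub_pairwise => A B neqAB.
apply/allrelP=> _ _ /mapP[p pA ->] /mapP[q qB ->]; apply/implyP=> /eqP eqAB.
(* Distinct faces of equal colour share no dart, as a dart has only one face on its right. *)
apply: contra neqAB => /(shared_vertex pA qB eqAB) /hasP[x xq xp].
by rewrite -(rface_strand pA xp) (rface_strand qB xq).
Qed.

(** * The two validity conditions along an edge *)

Section Edge.

Variable e : edge G.
Let a := color (e, false).
Let b := color (e, true).

Lemma alpha_base_stranding c : c != 0%N ->
  alpha S e c = (if c == b then 1 else if c == a then -1 else 0).
Proof.
by move=> c0; rewrite /alpha /Splus /Sminus !carries_base_stranding c0 !andbT.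
Qed.

Lemma alpha_sum : \sum_(1 <= c < n) alpha S e c * c%:Z = b%:Z - a%:Z.
Proof.
have b_lt : (b < n)%N by exact: dist_lt.
have a_lt : (a < n)%N by exact: dist_lt.
have neq_ab : a != b by exact: color_flip (e, true).
(* The added term is 0. With colour 0 in range, the formula also covers a side of the edge that
   carries no strand. *)
transitivity (\sum_(0 <= c < n) alpha S e c * c%:Z).
  by rewrite [RHS]big_ltn ?mulr0 ?add0r // ltnW.
rewrite big_mkord (eq_bigr (fun c : 'I_n =>
  (if c == Ordinal b_lt then b%:Z else 0) - (if c == Ordinal a_lt then a%:Z else 0))).
  by rewrite sumrB -!big_mkcond !big_pred1_eq.
move=> c _; rewrite -!val_eqE /=.
have [c0|c0] := eqVneq (c : nat) 0%N; first by rewrite c0 mulr0; do 2!case: eqP => [<-|].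
rewrite alpha_base_stranding //; have [->|_] := eqVneq (c : nat) b.
  by rewrite eq_sym (negPf neq_ab) mul1r subr0.
by have [->|_] := eqVneq (c : nat) a; rewrite ?mulN1r ?mul0r ?sub0r ?oppr0.
Qed.

Lemma base_stranding_alternating : alternating n S e.
Proof.
(* The stronger pairwise statement holds: two distinct colours with nonzero [alpha] can only be [a]
   and [b], with opposite signs. *)
rewrite /alternating filter_map sorted_map; apply: pairwise_sorted.
set P := preim _ _.
have lt_pair : pairwise ltn (iota 1 n.-1).
  by rewrite -sorted_pairwise ?iota_ltn_sorted //; exact: ltn_trans.
have := pairwise_filter P lt_pair.
apply: (sub_in_pairwise (P := [pred c | (c != 0%N) && P c])) => [c c'|]; last first.
  apply/allP=> c; rewrite mem_filter mem_iota => /andP[Pc /andP[c0 _]].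
  by rewrite inE Pc -lt0n c0.
rewrite !inE /P /= => /andP[c0 +] /andP[c'0 +]; rewrite !alpha_base_stranding //.
have [->|cb] := eqVneq c b; have [->|c'b] := eqVneq c' b; rewrite ?ltnn //.
- by case: (eqVneq c' a).
- by case: (eqVneq c a).
by case: (eqVneq c a) => // [->]; case: (eqVneq c' a) => // [->]; rewrite ltnn.
Qed.

Lemma base_stranding_weighted : weighted n S e.
Proof.
have := weight_range webG e; have := color_edge e; rewrite -/a -/b => ab wn.
(* The maximum is nonzero because [a] and [b] differ, so it is the colour of an actual strand. It
   equals [b] exactly when the addition does not wrap around. *)
exists (maxn a b); rewrite alpha_sum.
rewrite /Scolors /Splus /Sminus !carries_base_stranding -/a -/b.
split=> [|c|].
- by lia.
- by rewrite !carries_base_stranding -/a -/b; lia.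
- by case: ab => ?; case: ifP; lia.
Qed.

End Edge.

End Strands.

Theorem theorem54 (n : nat) (hn : (2 <= n)%N) (G : web n) :
  valid_stranding n (base_stranding G).
Proof.
split=> [|e]; first exact: base_strandingP.
by split; [exact: base_stranding_alternating | exact: base_stranding_weighted].
Qed.
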